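(* Let $K_{n+1}^C$ be the complete signed graph with loops on $[n+1]$, with edges $(i,j,-)$ and $(i,j,+)$ for all $1\le i<j\le n+1$ and loops $(i,i,+)$ for all $1\le i\le n+1$, each with multiplicity one. The polytope $CRYC_{n+1}=\mathcal{F}_{K^C_{n+1}}(2,0,\ldots,0)$ has exactly $3^n$ vertices.
   Context: For a signed graph $G$ on $[n+1]=\{1,\ldots,n+1\}$ associate to a negative edge $(i,j,-)$, $i<j$, the vector $\mathbf{e}_i-\mathbf{e}_j$, to a positive edge $(i,j,+)$ the vector $\mathbf{e}_i+\mathbf{e}_j$, and to a loop $(i,i,+)$ the vector $2\mathbf{e}_i$ in $\mathbb{R}^{n+1}$. Let $M_G$ be the matrix whose columns are these vectors. For $\mathbf{a}\in\mathbb{Z}^{n+1}$ the flow polytope is $\mathcal{F}_G(\mathbf{a})=\{f\in\mathbb{R}_{\ge0}^{E(G)}:M_Gf=\mathbf{a}\}$. *)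

(* Defs.v *)
From mathcomp Require Import all_boot all_order all_algebra.
From mathcomp Require Import boolp classical_sets functions cardinality reals.

Set Implicit Arguments.
Unset Strict Implicit.
Unset Printing Implicit Defensive.

Import Order.TTheory GRing.Theory Num.Theory.
Local Open Scope ring_scope.
Local Open Scope classical_set_scope.

(* The possible edges of a signed graph on 'I_m: triples (i, j, s) where the
   sign s is true for + and false for -. Either i < j and s is arbitrary, or
   i = j and s is + (a loop). Vertices are numbered from 0 instead of 1. *)
Definition sedge (m : nat) :=
  {e : 'I_m * 'I_m * bool | (e.1.1 < e.1.2)%N || (e.1.1 == e.1.2) && e.2}.

(* Multiple edges are allowed: distinct indices may carry the same sedge. *)
Record signed_graph (m : nat) := SignedGraph {
  edges : finType;
  edge_of : edges -> sedge m
}.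

(* e_i - e_j for (i, j, -) and e_i + e_j for (i, j, +); a loop (i, i, +) thus
   gets e_i + e_i = 2 e_i. *)
Definition edge_vec (R : pzRingType) (m : nat) (e : sedge m) : 'cV[R]_m :=
  let: (i, j, s) := val e in
  if s then delta_mx i 0 + delta_mx j 0 else delta_mx i 0 - delta_mx j 0.

(* Columns are indexed by the edges of G through the enumeration enum_val. *)
Definition incidence_mx (R : pzRingType) (m : nat) (G : signed_graph m) :
    'M[R]_(m, #|edges G|) :=
  \matrix_(i, k) edge_vec R (edge_of (enum_val k)) i 0.

Definition flow_polytope (R : realType) (m : nat) (G : signed_graph m)
    (a : 'cV[int]_m) : set 'cV[R]_#|edges G| :=
  [set f : 'cV[R]_#|edges G| |
    (forall k, 0 <= f k 0) /\ incidence_mx R G *m f = map_mx intr a].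

(* A face of P is the subset where an affine inequality valid on P is tight;
   P itself and the empty set are faces. *)
Definition is_face (R : realType) (d : nat) (P F : set 'cV[R]_d) : Prop :=
  exists (c : 'rV[R]_d) (c0 : R),
    (forall x, P x -> (c *m x) 0 0 <= c0) /\
    F = P `&` [set x : 'cV[R]_d | (c *m x) 0 0 = c0].

(* The vertices of P are its zero-dimensional faces. *)
Definition vertices (R : realType) (d : nat) (P : set 'cV[R]_d) :
    set 'cV[R]_d :=
  [set v | is_face P [set v]].

Definition complete_signed_graph (m : nat) : signed_graph m :=
  @SignedGraph m (sedge m) id.

(* CRYC R n is CRYC_{n+1}, on n+1 vertices. *)
Definition CRYC (R : realType) (n : nat) :
    set 'cV[R]_#|edges (complete_signed_graph n.+1)| :=
  flow_polytope (\col_i (if i == ord0 then 2 else 0)).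

Arguments CRYC R n : clear implicits.

(* Main.v *)
Require Import Defs.
From mathcomp Require Import all_boot all_order all_algebra.
From mathcomp Require Import boolp classical_sets functions cardinality reals.
From mathcomp Require Import zify ring lra.

(** Send two walkers out of vertex 0 and let them look at the vertices
1, ..., n in turn. If they stand together, the next vertex is skipped, or one
of them moves to it, or both do; if they stand apart, the next vertex is
skipped, or one of them moves, or the other one does. Every step offers three
options, so there are 3 ^ n walks, coded by words of length n over 'I_3. Sending
one unit of flow along each walker and joining their final positions p and q by
one unit on the positive edge (p, q), or on the loop if p = q, gives a point of
the polytope: the final edge absorbs exactly e_p + e_q. Walkers that have
parted never meet again, so the support of such a flow is a path from 0
followed by one cycle with a single positive edge (possibly a loop).

These walk flows are exactly the vertices. First, a flow supported in the
support of a walk flow equals it ([walk_flow_unique]), since the last move of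
the walk is forced by conservation at the last vertex and can be peeled off;
hence the sum of the coordinates outside the support exposes the walk flow.
Secondly, the support of every point f of the polytope contains the support of
a walk flow F ([walk_in_support]): some positive edge (i, j) carries flow,
because the net flows add up to 2, and walks from 0 to i and j are found
backwards, since a nonzero vertex that emits flow must receive some. Then
f + eps (f - F) stays in the polytope for small eps > 0, so a face equal to {f}
must contain F, and f = F. Finally the walk is recovered from the multiplicities
with which it uses the negative edges ([mult_inj]). *)

Set Implicit Arguments.
Unset Strict Implicit.
Unset Printing Implicit Defensive.

Import Order.TTheory GRing.Theory Num.Theory.
Local Open Scope ring_scope.

(** * Pairs of walkers *)

(** The positions of the two walkers form a pair s with s.1 <= s.2. Option 0
skips the vertex v and option 1 moves the walker at s.1. Option 2 moves both
walkers if they are together and the walker at s.2 if they are apart. So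
[moved] walkers leave from [mover] in each case. *)
Definition moved (d : 'I_3) (s : nat * nat) : nat :=
  match val d with 0 => 0 | 1 => 1 | _ => (s.1 == s.2).+1 end.

Definition mover (d : 'I_3) (s : nat * nat) : nat :=
  if val d == 2 then s.2 else s.1.

Definition move (d : 'I_3) (v : nat) (s : nat * nat) : nat * nat :=
  match val d with
  | 0 => s
  | 1 => (s.2, v)
  | _ => if s.1 == s.2 then (v, v) else (s.1, v)
  end.

(** The head of a word is the last decision, about vertex [size w]; the words
grow at the head so that the last move can be peeled off. *)
Fixpoint ends (w : seq 'I_3) : nat * nat :=
  if w is d :: w' then move d (size w').+1 (ends w') else (0, 0)%N.

Fixpoint mult (w : seq 'I_3) (i j : nat) : nat :=
  if w is d :: w' then
    (mult w' i j + moved d (ends w') *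
       ((i == mover d (ends w')) && (j == (size w').+1)))%N
  else 0.

(** All three options are the same operation on the multiset of positions:
[moved d s] copies of [mover d s] are replaced by as many copies of [v]. *)
Lemma move_count (d : 'I_3) (v : nat) (s : nat * nat) (u : nat) :
  ((u == (move d v s).1) + (u == (move d v s).2) + moved d s * (u == mover d s)
   = (u == s.1) + (u == s.2) + moved d s * (u == v))%N.
Proof.
case: s => p q; case: d => [[|[|[|//]]] ?]; rewrite /move /moved /mover /=.
- by [].
- lia.
- by case: (eqVneq p q) => [->|_] /=; lia.
Qed.

Lemma ends_le (w : seq 'I_3) : ((ends w).1 <= (ends w).2 <= size w)%N.
Proof.
elim: w => [//|d w]; case E: (ends w) => [p q] /= /andP[pq qw].
rewrite E; case: d => [[|[|[|//]]] ?]; rewrite /move /=; try lia.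
by case: (p == q) => /=; lia.
Qed.

Lemma mover_le (d : 'I_3) (w : seq 'I_3) : (mover d (ends w) <= size w)%N.
Proof. by have := ends_le w; rewrite /mover; case: ifP => _; lia. Qed.

Lemma mult_supp (w : seq 'I_3) (i j : nat) :
  mult w i j != 0%N -> (i < j <= size w)%N.
Proof.
elim: w => [//|d w IH] /=; have := mover_le d w.
have [->|/IH] := eqVneq (mult w i j) 0%N; last lia.
by case: andP => [[/eqP -> /eqP ->]|_]; rewrite ?muln0 //=; lia.
Qed.

Lemma mult_eq0 (w : seq 'I_3) (i j : nat) :
  ~~ (i < j <= size w)%N -> mult w i j = 0%N.
Proof. by move=> h; apply: contraNeq h => /mult_supp. Qed.

(** Only the last move uses edges into the last vertex, so forgetting these
edges leaves the multiplicities of the shorter walk, and the edges into the last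
vertex tell the three options apart. *)
Lemma mult_inj (w w' : seq 'I_3) : size w = size w' ->
  (forall i j, (i < j <= size w)%N -> mult w i j = mult w' i j) -> w = w'.
Proof.
elim: w w' => [|d w IH] [|d' w'] //= [sz] eqN.
have ew : w = w'.
  apply: IH => // i j ij; have := eqN i j; rewrite -sz.
  have -> : (j == (size w).+1) = false by lia.
  rewrite !andbF !muln0 !addn0; apply; lia.
subst w'; congr (_ :: _).
(* Comparing the edges from i into the last vertex. *)
have key i : (i <= size w)%N -> (moved d (ends w) * (i == mover d (ends w))
    = moved d' (ends w) * (i == mover d' (ends w)))%N.
  move=> iw; have := eqN i (size w).+1.
  by rewrite eqxx !andbT mult_eq0 ?ltnn ?andbF // !add0n; apply; lia.
have := ends_le w; case: (ends w) key => p q key /= /andP[pq qw].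
have := key p (leq_trans pq qw); have := key q qw.
have [-> //|dd'] := eqVneq d d'; rewrite /moved /mover /=.
case: d {key eqN} dd' => [[|[|[|//]]] ?]; case: d' => [[|[|[|//]]] ?] //= _;
  have [->|] := eqVneq p q; rewrite ?eqxx //=; lia.
Qed.

(** * Conservation along a walk *)

Definition divergence (R : pzRingType) (m : nat) (h : 'I_m -> 'I_m -> R)
    (v : 'I_m) : R :=
  \sum_j h v j - \sum_i h i v.

Lemma sum_delta (R : pzRingType) (m : nat) (a : R) (b : bool) (r : nat) :
  (r < m)%N ->
  \sum_(i < m) a * (b && (i == r :> nat))%:R = a * b%:R.
Proof.
move=> rm; rewrite (bigD1 (Ordinal rm)) //= eqxx andbT big1 ?addr0 // => i.
by rewrite -val_eqE /= => /negbTE ->; rewrite andbF mulr0.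
Qed.

Lemma divergence_delta (R : pzRingType) (m : nat) (a : R) (r s : nat)
    (v : 'I_m) : (r < m)%N -> (s < m)%N ->
  divergence (fun i j => a * ((i == r :> nat) && (j == s :> nat))%:R) v
  = a * (v == r :> nat)%:R - a * (v == s :> nat)%:R.
Proof.
move=> rm sm; rewrite /divergence sum_delta //; congr (_ - _).
by under eq_bigr do rewrite andbC; rewrite sum_delta.
Qed.

Lemma divergenceD (R : pzRingType) (m : nat) (h g : 'I_m -> 'I_m -> R)
    (v : 'I_m) :
  divergence (fun i j => h i j + g i j) v = divergence h v + divergence g v.
Proof. by rewrite /divergence !big_split /= opprD addrACA. Qed.

Lemma mult_divergence (R : realFieldType) (m : nat) (w : seq 'I_3) (v : 'I_m) :
  (size w < m)%N ->
  divergence (fun i j : 'I_m => (mult w i j)%:R : R) v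
    + (v == (ends w).1 :> nat)%:R + (v == (ends w).2 :> nat)%:R
  = (v == 0 :> nat)%:R *+ 2.
Proof.
elim: w => [|d w IH] /= sm.
  by rewrite /divergence !big1 // subr0 add0r mulr2n.
rewrite -IH; last exact: ltnW.
have -> : divergence (fun i j : 'I_m => (mult w i j + moved d (ends w)
    * ((i == mover d (ends w) :> nat) && (j == (size w).+1 :> nat)))%:R : R) v
  = divergence (fun i j : 'I_m => (mult w i j)%:R + (moved d (ends w))%:R
    * ((i == mover d (ends w) :> nat) && (j == (size w).+1 :> nat))%:R : R) v.
  by congr (_ - _); apply: eq_bigr => i _; rewrite natrD natrM.
rewrite divergenceD divergence_delta //; last first.
  by rewrite (leq_ltn_trans (mover_le d w)) // ltnW.
have := move_count d (size w).+1 (ends w) v => /(congr1 (fun k => k%:R : R)).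
rewrite !natrD !natrM; lra.
Qed.

(** Conservation at the vertex of the last move forces the flow on its only
incoming edge; subtracting that flow moves the demand back to the previous
positions of the walkers. The scale c is the flow on the final positive edge. *)
Lemma mult_unique (R : realFieldType) (m : nat) (w : seq 'I_3)
    (h : 'I_m -> 'I_m -> R) (c : R) :
  (size w < m)%N ->
  (forall i j : 'I_m, mult w i j = 0%N -> h i j = 0) ->
  (forall v : 'I_m, v != 0 :> nat ->
     divergence h v + c * (v == (ends w).1 :> nat)%:R
       + c * (v == (ends w).2 :> nat)%:R = 0) ->
  forall i j : 'I_m, h i j = c * (mult w i j)%:R.
Proof.
elim: w h => [|d w IH] h /= sm supp bal.
  by move=> i j; rewrite mulr0 supp.
set r := mover d (ends w); set k := moved d (ends w).
have rw : (r <= size w)%N by exact: mover_le.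
have rm : (r < m)%N by lia.
have count v := move_count d (size w).+1 (ends w) v.
pose M := Ordinal sm.
have new : h (Ordinal rm) M = c * k%:R.
  have := bal M isT; rewrite /divergence big1 => [|j _]; last first.
    by apply: supp; rewrite !mult_eq0 /= ?eqn_leq; lia.
  rewrite (bigD1 (Ordinal rm)) //= big1 => [|i]; last first.
    rewrite -val_eqE /= => /negbTE ir; apply: supp.
    by rewrite mult_eq0 ?ltnn ?andbF //= ir muln0.
  have := congr1 (fun x => x%:R : R) (count M); have := ends_le w => el.
  have -> : (M == (ends w).1 :> nat) = false by rewrite /=; lia.
  have -> : (M == (ends w).2 :> nat) = false by rewrite /=; lia.
  have -> : (M == mover d (ends w) :> nat) = false by rewrite /= -/r; lia.
  rewrite /= eqxx !add0n muln0 addn0 muln1 natrD -/k => <-; lra.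
pose h' i j := h i j
  + (- (c * k%:R)) * ((i == r :> nat) && (j == (size w).+1 :> nat))%:R.
have h'E : forall i j, h' i j = c * (mult w i j)%:R.
  apply: IH; first exact: ltnW.
  - move=> i j wij; rewrite /h'; case: andP => [[/eqP ir /eqP jM]|nij].
      have -> : i = Ordinal rm by exact: val_inj.
      have -> : j = M by exact: val_inj.
      by rewrite new mulr1 subrr.
    rewrite mulr0 addr0 supp // wij -/r add0n.
    by case: andP nij => // _; rewrite muln0.
  - move=> v v0; rewrite /h' divergenceD divergence_delta //.
    have := congr1 (fun x => c * x%:R : R) (count v); have := bal v v0.
    rewrite !natrD !natrM -/k -/r !mulrDr !mulrA; lra.
move=> i j; have := h'E i j; rewrite /h' natrD natrM -/k -/r mulrDr mulrA => <-.
by rewrite mulNr addrNK.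
Qed.

(** A pair (i, j) is reached by following predecessors from the larger of the
two vertices: if it is vertex l, its walker made the last move, and the
remaining pair lies below l. When the two coincide they move on together, so
walkers that were apart never have to be merged. *)
Lemma walk_exists (R : realFieldType) (m : nat) (h : 'I_m -> 'I_m -> R)
    (act : pred 'I_m) :
  (forall v : 'I_m, act v -> v != 0 :> nat ->
     exists2 u : 'I_m, (u < v)%N & act u && (h u v != 0)) ->
  forall (l : nat) (i j : 'I_m), (i <= j <= l)%N -> act i -> act j ->
  exists2 w : seq 'I_3, size w = l &
    ends w = (val i, val j) /\
    forall a b : 'I_m, mult w a b != 0%N -> h a b != 0.
Proof.
move=> active_pred; elim=> [|l IH] i j ijl ai aj.
  by exists [::] => //; split=> //=; congr (_, _); lia.
pose d0 : 'I_3 := @Ordinal 3 0 isT; pose d1 : 'I_3 := @Ordinal 3 1 isT.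
pose d2 : 'I_3 := @Ordinal 3 2 isT.
have [jl|lj] := leqP j l.
  have [|w sw [ew sup]] := IH i j _ ai aj; first lia.
  exists (d0 :: w); first by rewrite /= sw.
  by split=> // a b; rewrite /= /moved mul0n addn0; exact: sup.
have {lj}jE : val j = l.+1 by rewrite /=; lia.
have [|u uj /andP[au huj]] := active_pred j aj; first by rewrite jE.
have extend (d : 'I_3) w : size w = l -> mover d (ends w) = u ->
    (forall a b : 'I_m, mult w a b != 0%N -> h a b != 0) ->
    forall a b : 'I_m, mult (d :: w) a b != 0%N -> h a b != 0.
  move=> sw du sup a b /=; rewrite addn_eq0 negb_and => /orP[/sup //|].
  rewrite muln_eq0 negb_or du sw -jE eqb0 negbK => /andP[_ /andP[/eqP au' /eqP bj]].
  by rewrite (val_inj au') (val_inj bj).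
have [il|li] := leqP i l; last first.
  have -> : i = j by apply: val_inj; rewrite /=; lia.
  have [|w sw [ew sup]] := IH u u _ au au; first lia.
  exists (d2 :: w); first by rewrite /= sw.
  split; first by rewrite /= ew /move /= eqxx sw jE.
  by apply: extend => //; rewrite ew.
have [ui|iu] := leqP u i.
  have [|w sw [ew sup]] := IH u i _ au ai; first lia.
  exists (d1 :: w); first by rewrite /= sw.
  split; first by rewrite /= ew /move /= sw jE.
  by apply: extend => //; rewrite ew.
have [|w sw [ew sup]] := IH i u _ ai au; first lia.
exists (d2 :: w); first by rewrite /= sw.
split; last by apply: extend => //; rewrite ew.
by rewrite /= ew /move /= sw jE; case: eqP iu => // ->; rewrite ltnn.
Qed.

(** * Flows on the complete signed graph *)

Section Flow.
Local Open Scope classical_set_scope.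

Notation dim n := #|edges (complete_signed_graph n.+1)|.

(** The flow on the edge (i, j, s), extended by zero to the triples that are
not edges, so that net flows become plain double sums. *)
Definition edge_flow (R : realType) (n : nat) (f : 'cV[R]_(dim n))
    (s : bool) (i j : 'I_n.+1) : R :=
  if insub (i, j, s) is Some e then f (enum_rank (e : sedge n.+1)) 0 else 0.

Lemma edge_flowE (R : realType) (n : nat) (f : 'cV[R]_(dim n))
    (e : sedge n.+1) :
  edge_flow f (val e).2 (val e).1.1 (val e).1.2 = f (enum_rank e) 0.
Proof.
rewrite /edge_flow; have -> : ((val e).1.1, (val e).1.2, (val e).2) = val e.
  by case: (val e) => [[i j] s].
by rewrite valK.
Qed.

Lemma edge_flow_ge0 (R : realType) (n : nat) (f : 'cV[R]_(dim n)) s i j :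
  (forall k, 0 <= f k 0) -> 0 <= edge_flow f s i j.
Proof. by move=> f0; rewrite /edge_flow; case: insub. Qed.

Lemma edge_flow_supp (R : realType) (n : nat) (f : 'cV[R]_(dim n)) s
    (i j : 'I_n.+1) :
  edge_flow f s i j != 0 -> (i < j)%N || (i == j) && s.
Proof. by rewrite /edge_flow; case: insubP => //=; rewrite eqxx. Qed.

Lemma sum_sig (V : nmodType) (I : finType) (P : pred I) (F : I -> V) :
  (forall i, ~~ P i -> F i = 0) -> \sum_(x : {x | P x}) F (val x) = \sum_i F i.
Proof.
move=> F0; rewrite [RHS](bigID P) /= [X in _ = _ + X]big1 // addr0.
rewrite (reindex_omap (val : {x | P x} -> I) insub); last first.
  by move=> i Pi; rewrite insubT.
by apply: eq_bigl => -[i Pi] /=; rewrite insubT Pi /= eqxx.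
Qed.

Lemma incidence_mulE (R : realType) (n : nat) (f : 'cV[R]_(dim n)) (v : 'I_n.+1) :
  (incidence_mx R (complete_signed_graph n.+1) *m f) v 0
  = divergence (edge_flow f false) v
    + \sum_j edge_flow f true v j + \sum_i edge_flow f true i v.
Proof.
pose vec (t : 'I_n.+1 * 'I_n.+1 * bool) : R :=
  if t.2 then (v == t.1.1)%:R + (v == t.1.2)%:R
  else (v == t.1.1)%:R - (v == t.1.2)%:R.
pose F (t : 'I_n.+1 * 'I_n.+1 * bool) : R := vec t * edge_flow f t.2 t.1.1 t.1.2.
have -> : (incidence_mx R (complete_signed_graph n.+1) *m f) v 0 =
    \sum_(e : sedge n.+1) F (val e).
  rewrite mxE (reindex_onto enum_rank enum_val) /=; last first.
    by move=> k _; exact: enum_valK.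
  rewrite (eq_bigl predT) => [|e]; last by rewrite enum_rankK eqxx.
  apply: eq_bigr => e _; rewrite /F edge_flowE; congr (_ * _).
  rewrite mxE enum_rankK /edge_vec /vec; case: e => [[[i j] []] ?] /=.
    by rewrite !mxE eqxx !andbT.
  by rewrite !mxE eqxx !andbT.
rewrite (sum_sig (P := fun t : 'I_n.+1 * 'I_n.+1 * bool =>
  (t.1.1 < t.1.2)%N || (t.1.1 == t.1.2) && t.2)) => [|[[i j] s]]; last first.
  rewrite /F; case: (eqVneq (edge_flow f s i j) 0) => [/= ->|]; first by rewrite mulr0.
  by move=> /edge_flow_supp /= ->.
have sumL (g : 'I_n.+1 -> 'I_n.+1 -> R) :
    \sum_i \sum_j (v == i)%:R * g i j = \sum_j g v j.
  rewrite (bigD1 v) //= [X in _ + X]big1 ?addr0 => [|i iv].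
    by apply: eq_bigr => j _; rewrite eqxx mul1r.
  by rewrite big1 // => j _; rewrite eq_sym (negbTE iv) mul0r.
have sumR (g : 'I_n.+1 -> 'I_n.+1 -> R) :
    \sum_i \sum_j (v == j)%:R * g i j = \sum_i g i v.
  by rewrite exchange_big /= (sumL (fun j i => g i j)).
rewrite -(pair_bigA _ (fun ij s => F (ij, s))) /=.
rewrite -(pair_bigA _ (fun i j => \sum_s F ((i, j), s))) /=.
rewrite /divergence -(sumL (edge_flow f false)) -(sumR (edge_flow f false)).
rewrite -(sumL (edge_flow f true)) -(sumR (edge_flow f true)).
rewrite -sumrB -!big_split /=; apply: eq_bigr => i _; rewrite -sumrB -!big_split /=.
by apply: eq_bigr => j _; rewrite big_bool /F /vec /=; ring.
Qed.

(** * Walk flows are the vertices *)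

Definition walk_flow (R : realType) (n : nat) (w : seq 'I_3) : 'cV[R]_(dim n) :=
  \col_k let: (i, j, s) := val (enum_val k : sedge n.+1) in
         if s then ((val i, val j) == ends w)%:R else (mult w i j)%:R.

Lemma walk_flow_neg (R : realType) (n : nat) (w : seq 'I_3) (i j : 'I_n.+1) :
  edge_flow (walk_flow R n w) false i j = (mult w i j)%:R.
Proof.
rewrite /edge_flow; case: insubP => [e _ eE|] /=.
  by rewrite mxE enum_rankK eE.
by rewrite andbF orbF => ij; rewrite mult_eq0 // negb_and ij.
Qed.

Lemma walk_flow_pos (R : realType) (n : nat) (w : seq 'I_3) (i j : 'I_n.+1) :
  edge_flow (walk_flow R n w) true i j = ((val i, val j) == ends w)%:R.
Proof.
rewrite /edge_flow; case: insubP => [e _ eE|] /=.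
  by rewrite mxE enum_rankK eE.
rewrite andbT -val_eqE orbC -leq_eqVlt -ltnNge; case: eqP => // ew.
by have := ends_le w; rewrite -ew /=; lia.
Qed.

Lemma edge_flow_inj (R : realType) (n : nat) (f g : 'cV[R]_(dim n)) :
  (forall s i j, edge_flow f s i j = edge_flow g s i j) -> f = g.
Proof.
move=> fg; apply/colP => k.
by rewrite -(enum_valK k) -!(edge_flowE _ (enum_val k : sedge n.+1)) fg.
Qed.

Lemma sum_ends (R : realType) (n : nat) (w : seq 'I_3) (c : R) (v : 'I_n.+1) :
  (size w < n.+1)%N ->
  \sum_(j < n.+1) c * ((val v, val j) == ends w)%:R
    + \sum_(i < n.+1) c * ((val i, val v) == ends w)%:R
  = c * (v == (ends w).1 :> nat)%:R + c * (v == (ends w).2 :> nat)%:R.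
Proof.
move=> wn; have := ends_le w; case: (ends w) => p q /= pq.
under eq_bigr do rewrite xpair_eqE.
under [X in _ + X]eq_bigr do rewrite xpair_eqE andbC.
by rewrite !sum_delta //; lia.
Qed.

Lemma CRYC_netflow (R : realType) (n : nat) (f : 'cV[R]_(dim n)) :
  CRYC R n f <-> (forall k, 0 <= f k 0) /\
    forall v : 'I_n.+1, divergence (edge_flow f false) v
      + \sum_j edge_flow f true v j + \sum_i edge_flow f true i v
      = (v == 0 :> nat)%:R *+ 2.
Proof.
have aE (v : 'I_n.+1) : map_mx intr (\col_i (if i == ord0 then 2 else 0)) v 0
    = (v == 0 :> nat)%:R *+ 2 :> R.
  by rewrite !mxE -val_eqE /=; case: (v == 0 :> nat); rewrite ?mul0rn.
split=> -[f0 fa]; split=> //.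
  by move=> v; rewrite -incidence_mulE fa aE.
by apply/colP => v; rewrite incidence_mulE fa aE.
Qed.

Lemma walk_flow_CRYC (R : realType) (n : nat) (w : seq 'I_3) :
  size w = n -> CRYC R n (walk_flow R n w).
Proof.
move=> wn; apply/CRYC_netflow; split=> [k|v].
  by rewrite mxE; case: (val _) => [[i j] []]; rewrite ler0n.
have wn1 : (size w < n.+1)%N by rewrite wn.
rewrite -(mult_divergence R v wn1) -addrA -[RHS]addrA; congr (_ + _).
  by rewrite /divergence; congr (_ - _); apply: eq_bigr => i _;
    rewrite walk_flow_neg.
have := sum_ends (1 : R) v wn1; rewrite !mul1r => <-.
by congr (_ + _); apply: eq_bigr => i _; rewrite walk_flow_pos mul1r.
Qed.

(** [mult_unique] determines the negative edges up to the scale c given by the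
final positive edge, and the net flow 2 at vertex 0 gives c = 1. *)
Lemma walk_flow_unique (R : realType) (n : nat) (w : seq 'I_3)
    (f : 'cV[R]_(dim n)) :
  size w = n -> CRYC R n f ->
  (forall k, walk_flow R n w k 0 = 0 -> f k 0 = 0) -> f = walk_flow R n w.
Proof.
move=> wn Pf supp; have wn1 : (size w < n.+1)%N by rewrite wn.
have [_ fa] := (CRYC_netflow f).1 Pf.
have [_ wa] := (CRYC_netflow _).1 (walk_flow_CRYC R wn).
have flow0 s i j : edge_flow (walk_flow R n w) s i j = 0 -> edge_flow f s i j = 0.
  by rewrite /edge_flow; case: insub => // e; exact: supp.
have [pn qn] : ((ends w).1 < n.+1)%N /\ ((ends w).2 < n.+1)%N.
  by have := ends_le w; lia.
pose c := edge_flow f true (Ordinal pn) (Ordinal qn).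
have posE i j : edge_flow f true i j = c * edge_flow (walk_flow R n w) true i j.
  rewrite walk_flow_pos; case: eqP => [ew|nw].
    rewrite mulr1 /c; congr edge_flow; apply: val_inj => /=; by rewrite -ew.
  by rewrite mulr0 flow0 // walk_flow_pos; case: eqP.
have negE i j : edge_flow f false i j = c * edge_flow (walk_flow R n w) false i j.
  rewrite walk_flow_neg; apply: mult_unique => // [a b wab|v v0].
    by rewrite flow0 // walk_flow_neg wab.
  have := fa v; rewrite (negbTE v0) mul0rn.
  have := sum_ends c v wn1.
  under eq_bigr do rewrite -walk_flow_pos -posE.
  under [X in _ + X = _]eq_bigr do rewrite -walk_flow_pos -posE.
  lra.
have c1 : c = 1.
  have := fa ord0; have := wa ord0 => /= w0.
  have -> : divergence (edge_flow f false) ord0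
      = c * divergence (edge_flow (walk_flow R n w) false) ord0.
    by rewrite /divergence mulrBr !mulr_sumr; congr (_ - _);
       apply: eq_bigr => a _; rewrite negE.
  under eq_bigr do rewrite posE.
  under [X in _ + X]eq_bigr do rewrite posE.
  by rewrite -!mulr_sumr -!mulrDr w0 /=; lra.
by apply: edge_flow_inj => -[] i j; rewrite (posE, negE) c1 mul1r.
Qed.

(** Vertices emitting flow satisfy the hypothesis of [walk_exists] on
predecessors, and the endpoints of a positive edge in the support emit flow, so
a walk ends at them. Here [out v] is the total flow leaving v, that is, through negative edges to
larger vertices and through positive edges at v. A loop counts twice. *)
Lemma walk_in_support (R : realType) (n : nat) (f : 'cV[R]_(dim n)) :
  CRYC R n f ->
  exists2 w : seq 'I_3, size w = n &
    forall k, f k 0 = 0 -> walk_flow R n w k 0 = 0.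
Proof.
case/CRYC_netflow => f0 fa.
pose h := edge_flow f false; pose g := edge_flow f true.
have h0 i j : 0 <= h i j by exact: edge_flow_ge0.
have g0 i j : 0 <= g i j by exact: edge_flow_ge0.
pose out (v : 'I_n.+1) := \sum_j h v j + \sum_j g v j + \sum_i g i v.
have outE v : out v - \sum_i h i v = (v == 0 :> nat)%:R *+ 2.
  by rewrite -fa /out /divergence /h /g; lra.
have sum_ge0 (F : 'I_n.+1 -> R) : (forall i, 0 <= F i) -> 0 <= \sum_i F i.
  by move=> F0; apply: sumr_ge0.
have term_gt0 (F : 'I_n.+1 -> R) i : (forall i, 0 <= F i) -> F i != 0 ->
    0 < \sum_i F i.
  move=> F0 Fi; rewrite (bigD1 i) //=; apply: ltr_pwDl.
    by rewrite lt_def Fi F0.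
  by apply: sumr_ge0.
have active_pred (v : 'I_n.+1) : 0 < out v -> v != 0 :> nat ->
    exists2 u : 'I_n.+1, (u < v)%N & (0 < out u) && (h u v != 0).
  move=> ov /negbTE v0; have := outE v; rewrite v0 mul0rn => inE.
  have [u huv] : exists u, h u v != 0.
    apply/existsP; rewrite -[X in is_true X]negbK; apply/negP => /existsPn hz.
    move: ov; have -> : out v = \sum_i h i v by lra.
    by rewrite big1 ?ltxx // => i _; apply/eqP; have := hz i; rewrite negbK.
  exists u; first by have := edge_flow_supp huv; rewrite andbF orbF.
  rewrite huv andbT /out -addrA ltr_pwDl ?addr_ge0 ?sum_ge0 //.
  by apply: (term_gt0 (h u) v).
(* Each negative edge contributes 1 - 1 to the sum of the net flows, so without
positive edges this sum would be 0 instead of 2. *)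
have [i [j gij]] : exists i j, g i j != 0.
  apply/not_existsP => nog.
  have gz i j : g i j = 0.
    by apply/eqP; apply: contrapT => gij; apply: (nog i); exists j; apply/negP.
  have total : \sum_v (out v - \sum_i h i v) = 2.
    rewrite (bigD1 ord0) //= outE /= big1 ?addr0 // => v.
    by rewrite -val_eqE outE /= => /negbTE ->; rewrite mul0rn.
  have : \sum_v (out v - \sum_i h i v) = 0.
    rewrite sumrB /out; under eq_bigr => v _ do
      rewrite [\sum_j g v j]big1 ?[\sum_i g i v]big1 ?addr0 //.
    by rewrite exchange_big subrr.
  by rewrite total; lra.
have oi : 0 < out i.
  rewrite /out addrAC ltr_wpDl ?addr_ge0 ?sum_ge0 //.
  by apply: (term_gt0 (g i) j).
have oj : 0 < out j.
  rewrite /out ltr_wpDl ?addr_ge0 ?sum_ge0 //.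
  by apply: (term_gt0 (fun i => g i j) i).
have ij : (i <= j <= n)%N.
  have := edge_flow_supp gij; have := ltn_ord j; rewrite andbT -val_eqE /=; lia.
have [w wn [ew sup]] := walk_exists active_pred ij oi oj.
exists w => // k.
rewrite -(enum_valK k) -!(edge_flowE _ (enum_val k : sedge n.+1)).
case: (val _) => [[a b] s] /=; case: s => fk.
  rewrite walk_flow_pos ew; case: eqP => // -[/val_inj ai /val_inj bj].
  by move: gij; rewrite /g -ai -bj fk eqxx.
rewrite walk_flow_neg; have [->//|/sup] := eqVneq (mult w a b) 0%N.
by rewrite /h fk eqxx.
Qed.

(** The walk flow is exposed by minus the sum of the coordinates that vanish on
it. *)
Lemma walk_flow_vertex (R : realType) (n : nat) (w : seq 'I_3) :
  size w = n -> vertices (CRYC R n) (walk_flow R n w).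
Proof.
move=> wn; set F := walk_flow R n w.
pose c : 'rV[R]_(dim n) := \row_k - (F k 0 == 0)%:R.
have cE x : (c *m x) 0 0 = - \sum_(k | F k 0 == 0) x k 0.
  rewrite mxE [in RHS]big_mkcond -sumrN; apply: eq_bigr => k _; rewrite mxE.
  by case: ifP => _; rewrite ?mulN1r // oppr0 mul0r.
exists c, 0; split=> [x [x0 _]|].
  by rewrite cE oppr_le0 sumr_ge0.
apply/seteqP; split=> [_ ->|x /= [Px]].
  split; first exact: walk_flow_CRYC.
  by rewrite /= cE big1 ?oppr0 // => k /eqP.
rewrite cE => /eqP; rewrite oppr_eq0 psumr_eq0 => [|k _]; last by case: Px => + _; apply.
move=> /allP x0; apply: walk_flow_unique => // k Fk.
by have := x0 k (mem_index_enum _); rewrite Fk eqxx => /eqP.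
Qed.

(** With F a walk flow supported in the support of f, the point
f + eps (f - F) of the polytope bounds c f from above by c F. *)
Lemma vertex_walk_flow (R : realType) (n : nat) (f : 'cV[R]_(dim n)) :
  vertices (CRYC R n) f -> exists2 w, size w = n & f = walk_flow R n w.
Proof.
case=> c [c0 [valid face]].
have [Pf cf] : (CRYC R n `&` [set x | (c *m x) 0 0 = c0]) f by rewrite -face.
have [w wn sup] := walk_in_support Pf; exists w => //.
set F := walk_flow R n w in sup *.
have PF : CRYC R n F by exact: walk_flow_CRYC.
suff cF : (c *m F) 0 0 = c0.
  by have : [set f] F by rewrite face; split.
apply/eqP; rewrite eq_le valid //=.
have [eps eps0 epsP] : exists2 eps : R, 0 < eps & forall k, eps * F k 0 <= f k 0.
  (* The ratio test; the cap 1 only serves as the unit of the minimum. *)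
  exists (\big[Num.min/1]_(k | F k 0 != 0) (f k 0 / F k 0)).
    apply: lt_bigmin => // k Fk; apply: divr_gt0; rewrite lt_def.
      by rewrite Pf.1 andbT; apply: contraNneq Fk => /sup ->.
    by rewrite Fk PF.1.
  move=> k; have [->|Fk] := eqVneq (F k 0) 0; first by rewrite mulr0 Pf.1.
  rewrite -ler_pdivlMr; last by rewrite lt_def Fk PF.1.
  exact: bigmin_le_cond.
have : CRYC R n ((1 + eps) *: f - eps *: F).
  case: Pf PF => f0 fa [F0 Fa]; split=> [k|].
    have -> : ((1 + eps) *: f - eps *: F) k 0 = (1 + eps) * f k 0 - eps * F k 0.
      by rewrite !mxE.
    have := epsP k; have := f0 k; have := mulr_ge0 (ltW eps0) (f0 k); lra.
  rewrite mulmxBr -!scalemxAr fa Fa -scalerBl addrK scale1r //.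
move/valid; rewrite mulmxBr -!scalemxAr.
have -> : ((1 + eps) *: (c *m f) - eps *: (c *m F)) 0 0
    = (1 + eps) * (c *m f) 0 0 - eps * (c *m F) 0 0 by rewrite !mxE.
rewrite cf => le; rewrite -(ler_pM2l eps0); lra.
Qed.
End Flow.

Lemma walk_flow_inj (R : realType) (n : nat) (w w' : seq 'I_3) :
  size w = n -> size w' = n -> walk_flow R n w = walk_flow R n w' -> w = w'.
Proof.
move=> wn wn' ww'; apply: mult_inj => [|i j ijn]; first by rewrite wn.
have [im jm] : (i < n.+1)%N /\ (j < n.+1)%N by lia.
have := walk_flow_neg R w (Ordinal im) (Ordinal jm); rewrite ww' walk_flow_neg.
by move/eqP; rewrite eqr_nat => /eqP.
Qed.

Local Open Scope classical_set_scope.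
Local Open Scope card_scope.

Theorem proposition3p15 (R : realType) (n : nat) :
  vertices (CRYC R n) #= `I_(3 ^ n)%N.
Proof.
have -> : vertices (CRYC R n) =
    (fun w : n.-tuple 'I_3 => walk_flow R n w) @` [set: n.-tuple 'I_3].
  apply/seteqP; split=> [f /vertex_walk_flow[w wn ->]|_ [w _ <-]].
    by exists (@Tuple n _ w (introT eqP wn)).
  exact/walk_flow_vertex/size_tuple.
have flows_words : [set walk_flow R n w | w in [set: n.-tuple 'I_3]]
    #= [set: n.-tuple 'I_3].
  apply: inj_card_eq => w w' _ _ /walk_flow_inj ww'.
  by apply: val_inj; apply: ww'; rewrite size_tuple.
have words_nat : [set: n.-tuple 'I_3] #= `I_#|{: n.-tuple 'I_3}|.
  apply/pcard_eqP/bijPex; exists (fun w => enum_rank w : nat); split.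
  - by move=> w _; exact: ltn_ord.
  - by move=> w w' _ _ /val_inj /enum_rank_inj.
  - by move=> k kn; exists (enum_val (Ordinal kn)); rewrite ?enum_valK.
apply: card_eq_trans flows_words _.
by move: words_nat; rewrite card_tuple card_ord.
Qed.
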